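(* There is no tuple $((Z_i)_{i\in2},S_0,S_1)$, where $Z_0,Z_1$ are Polish spaces and $S_0,S_1$ are disjoint analytic subsets of $Z_0\times Z_1$, such that for every tuple $((X_i)_{i\in2},B_0,B_1)$ with $X_0,X_1$ Polish and $B_0,B_1$ disjoint analytic subsets of $X_0\times X_1$ exactly one of the following holds: (a) $B_0$ is separable from $B_1$ by a $\mathrm{pot}(\Delta^0_1)$ set; (b) $((Z_i)_{i\in2},S_0,S_1)\sqsubseteq((X_i)_{i\in2},B_0,B_1)$.
   Context: A Borel $B\subseteq X_0\times X_1$ is $\mathrm{pot}(\Delta^0_1)$ if there are finer 0-dimensional Polish topologies $\tau_i$ on $X_i$ with $B$ clopen in $(X_0,\tau_0)\times(X_1,\tau_1)$; ''$B_0$ is separable from $B_1$ by a $\mathrm{pot}(\Delta^0_1)$ set'' means some such set contains $B_0$ and is disjoint from $B_1$. $((Z_i)_{i\in2},S_0,S_1)\sqsubseteq((X_i)_{i\in2},B_0,B_1)$ means there are continuous $f_i:Z_i\to X_i$ ($i\in\{0,1\}$) such that $(f_0\times f_1)$ restricted to $S_0\cup S_1$ is one-to-one and $S_\varepsilon\subseteq(f_0\times f_1)^{-1}(B_\varepsilon)$ for each $\varepsilon\in\{0,1\}$. *)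

(* Defs.v *)
From HB Require Import structures.
From mathcomp Require Import all_boot all_order all_algebra.
From mathcomp Require Import all_classical all_reals all_analysis.

Set Implicit Arguments.
Unset Strict Implicit.
Unset Printing Implicit Defensive.

Import Order.TTheory GRing.Theory Num.Theory.

Local Open Scope classical_set_scope.
Local Open Scope ring_scope.

Definition is_metric (R : realType) (T : Type) (d : T -> T -> R) : Prop :=
  [/\ forall x y, 0 <= d x y,
      forall x y, d x y = 0 <-> x = y,
      forall x y, d x y = d y x &
      forall x y z, d x z <= d x y + d y z].

Definition metric_compatible (R : realType) (T : topologicalType)
    (d : T -> T -> R) : Prop :=
  forall U : set T, open U <->
    forall x, U x -> exists2 e : R, 0 < e & [set y | d x y < e] `<=` U.

Definition metric_complete (R : realType) (T : topologicalType)
    (d : T -> T -> R) : Prop :=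
  forall u : nat -> T,
    (forall e : R, 0 < e -> exists N : nat, forall m n : nat,
       (N <= m)%N -> (N <= n)%N -> d (u m) (u n) < e) ->
    exists l : T, u @ \oo --> l.

Definition separable_space (T : topologicalType) : Prop :=
  exists2 D : set T, countable D & dense D.

Definition polish (R : realType) (T : topologicalType) : Prop :=
  separable_space T /\
  exists d : T -> T -> R,
    [/\ is_metric d, metric_compatible d & metric_complete d].

(* Continuous image of a Polish space; taking the empty space for [P] shows that
   the empty set is analytic. *)
Definition analytic (R : realType) (T : topologicalType) (A : set T) : Prop :=
  exists (P : topologicalType) (f : P -> T),
    [/\ polish R P, continuous f & range f = A].

Definition borel (T : topologicalType) (A : set T) : Prop :=
  <<s @open T >> A.

(* The library's [zero_dimensional] only asks that clopen sets separate points,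
   which is weaker than having a basis of clopen sets, even for Polish spaces. *)
Definition clopen_basis (T : topologicalType) : Prop := basis (@clopen T).

(* An element [c : Topological T] is a topology on the carrier [T], and
   [Topological.Pack c] is [T] equipped with that topology. *)
Definition finer (T : topologicalType) (c : Topological T) : Prop :=
  forall U : set T, open U -> @open (Topological.Pack c) U.

Definition pot_clopen (R : realType) (X0 X1 : topologicalType)
    (B : set (X0 * X1)) : Prop :=
  borel B /\
  exists (c0 : Topological X0) (c1 : Topological X1),
    let Y0 := Topological.Pack c0 in
    let Y1 := Topological.Pack c1 in
    [/\ finer c0 /\ finer c1,
        polish R Y0 /\ polish R Y1,
        clopen_basis Y0 /\ clopen_basis Y1 &
        @clopen (Y0 * Y1)%type B].

Definition pot_clopen_separable (R : realType) (X0 X1 : topologicalType)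
    (B0 B1 : set (X0 * X1)) : Prop :=
  exists C : set (X0 * X1),
    [/\ pot_clopen R C, B0 `<=` C & C `&` B1 = set0].

Definition prod_map (Z0 Z1 X0 X1 : Type) (f0 : Z0 -> X0) (f1 : Z1 -> X1) :
    Z0 * Z1 -> X0 * X1 :=
  fun z => (f0 z.1, f1 z.2).

Definition reduces (Z0 Z1 : topologicalType) (S0 S1 : set (Z0 * Z1))
    (X0 X1 : topologicalType) (B0 B1 : set (X0 * X1)) : Prop :=
  exists (f0 : Z0 -> X0) (f1 : Z1 -> X1),
    [/\ continuous f0, continuous f1,
        {in S0 `|` S1 &, injective (prod_map f0 f1)},
        S0 `<=` prod_map f0 f1 @^-1` B0 &
        S1 `<=` prod_map f0 f1 @^-1` B1].

Definition disjoint_analytic_tuple (R : realType) (X0 X1 : topologicalType)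
    (B0 B1 : set (X0 * X1)) : Prop :=
  [/\ polish R X0 /\ polish R X1,
      analytic R B0, analytic R B1 & B0 `&` B1 = set0].

Definition exactly_one (P Q : Prop) : Prop := (P /\ ~ Q) \/ (~ P /\ Q).

(* Main.v *)
(* Testing a hypothetical minimum [(S0, S1)] against the diagonal of the Baire
   space and its complement, in both orders, shows that it maps injectively,
   by some [h], to a pair [(B0, B1)] of disjoint analytic sets all of whose
   vertical sections have at most one point. Such a pair is separable: the
   cylinders [y i = j] separate the two possible values over each [x], and
   Luzin's theorem provides a countable Borel partition of the [x]-axis on each
   piece of which a single cylinder works. So [(B0, B1)] is both separable and
   above [(S0, S1)]. Polish topologies on the Baire space are presented by
   codes, that is, maps from the Baire space to itself; a Borel set is made
   clopen by adding coordinates to a code. *)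
Require Import Defs.
From HB Require Import structures.
From mathcomp Require Import all_boot all_order all_algebra.
From mathcomp Require Import all_classical all_reals all_analysis.

Set Implicit Arguments.
Unset Strict Implicit.
Unset Printing Implicit Defensive.

Import Order.TTheory GRing.Theory Num.Theory.

Local Open Scope classical_set_scope.
Local Open Scope ring_scope.

Local Notation seqs := (nat -> nat).

(** * Codes of finer Polish topologies on the Baire space *)

Definition code := seqs -> seqs.

Definition agree (e : code) (n : nat) (x y : seqs) : Prop :=
  forall i, (i < n)%N -> e x i = e y i.

Lemma agree_refl (e : code) n x : agree e n x x.
Proof. by []. Qed.

Lemma agree_sym (e : code) n x y : agree e n x y -> agree e n y x.
Proof. by move=> xy i /xy. Qed.

Lemma agree_trans (e : code) n x y z :
  agree e n x y -> agree e n y z -> agree e n x z.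
Proof. by move=> xy yz i lt_in; rewrite xy ?yz. Qed.

Lemma agree_le (e : code) m n x y :
  (m <= n)%N -> agree e n x y -> agree e m x y.
Proof. by move=> le_mn xy i lt_im; apply: xy; apply: leq_trans le_mn. Qed.

Definition pointwise_to (u : nat -> seqs) (a : seqs) : Prop :=
  forall n, exists K, forall k, (K <= k)%N -> u k n = a n.

Lemma pointwise_to_unique u a b :
  pointwise_to u a -> pointwise_to u b -> a = b.
Proof.
move=> ua ub; apply/funext => n; have [K uK] := ua n; have [L uL] := ub n.
by rewrite -(uK (maxn K L)) ?leq_maxl // uL ?leq_maxr.
Qed.

Lemma pointwise_to_shift u a m :
  pointwise_to u a -> pointwise_to (fun k => u (m + k)%N) a.
Proof.
move=> ua n; have [K uK] := ua n; exists K => k le_Kk; apply: uK.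
exact: leq_trans le_Kk (leq_addl _ _).
Qed.

(* Equivalently, [e] is injective with closed range and its inverse is
   continuous: the topology induced by [e] is finer and Polish. *)
Definition good_code (e : code) : Prop :=
  forall u a, pointwise_to (e \o u) a ->
  exists2 x, e x = a & pointwise_to u x.

Lemma good_id : good_code id.
Proof. by move=> u a ua; exists a. Qed.

(** When [e x = e y], a sequence alternating between [x] and [y] has constant image, so goodness
    makes it converge, which forces [x = y]. *)
Lemma good_code_inj e : good_code e -> injective e.
Proof.
move=> ge x y exy.
have [|z _ xyz] := ge (fun k => if odd k then x else y) (e y).
  by move=> n; exists 0%N => k _ /=; case: ifP; rewrite ?exy.
have xz : x = z.
  apply: (@pointwise_to_unique (fun=> x)); first by move=> n; exists 0%N.
  move=> n; have [K uK] := xyz n; exists K => k le_Kk.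
  have := uK (K.*2.+1); rewrite /= odd_double; apply.
  by rewrite -addnn -addnS leq_addr.
have yz : y = z.
  apply: (@pointwise_to_unique (fun=> y)); first by move=> n; exists 0%N.
  move=> n; have [K uK] := xyz n; exists K => k le_Kk.
  have := uK (K.*2); rewrite /= odd_double; apply.
  by rewrite -addnn leq_addr.
by rewrite xz yz.
Qed.

(** Otherwise some [u m] agrees with [x] up to [m] under [e] but not on the first [n] entries, for
    every [m]. The images converge to [e x], so [u] converges to [x], a contradiction. *)
Lemma good_code_finer e n x : good_code e ->
  exists m, forall y, agree e m x y -> agree id n x y.
Proof.
move=> ge; apply: contrapT => /forallNP H.
have {}H m : exists y, agree e m x y /\ ~ agree id n x y.
  by have /existsNP[y /not_implyP] := H m; exists y.
have [u uP] := choice H.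
have [|z ez uz] := ge u (e x).
  move=> i; exists i.+1 => k lt_ik /=; apply/esym.
  by have [+ _] := uP k; apply.
move: uz; have -> : z = x by exact: good_code_inj ge _ _ ez.
move=> ux {z ez}.
have [K uK] := choice ux.
pose M := (\max_(i < n) K i)%N.
have [_] := uP M; apply=> i lt_in /=.
by rewrite (uK i) //; apply: (leq_bigmax (Ordinal lt_in)).
Qed.

(** Numbers that code no pair go to [(0, 0)], where a joined code merely repeats a coordinate. *)
Definition unpair (n : nat) : nat * nat := odflt (0, 0)%N (unpickle n).

Lemma unpairK i j : unpair (pickle (i, j)) = (i, j).
Proof. by rewrite /unpair pickleK. Qed.

Definition join_code (e : nat -> code) : code :=
  fun x n => e (unpair n).1 x (unpair n).2.

Lemma join_codeE e i j x : join_code e x (pickle (i, j)) = e i x j.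
Proof. by rewrite /join_code unpairK. Qed.

(** Convergence of the joined images gives a limit for each [e i]; these coincide because each is
    the pointwise limit of [u]. *)
Lemma good_join e : (forall i, good_code (e i)) -> good_code (join_code e).
Proof.
move=> ge u a ua.
have ei i : exists2 x, e i x = (fun j => a (pickle (i, j))) & pointwise_to u x.
  apply: ge => j; have [K uK] := ua (pickle (i, j)).
  by exists K => k /uK <- /=; rewrite join_codeE.
have [x ex ux] := ei 0%N; exists x => //; apply/funext => n.
have [y ey uy] := ei (unpair n).1.
rewrite /join_code (pointwise_to_unique ux uy).
have [K uK] := ua n.
(* [n] may differ from [pickle (unpair n)], so convergence is also read at the latter index. *)
have [L uL] : exists L, forall k, (L <= k)%N ->
    e (unpair n).1 (u k) (unpair n).2 = e (unpair n).1 y (unpair n).2.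
  have [L uL] := ua (pickle (unpair n)).
  exists L => k /uL; rewrite /= /join_code /unpair pickleK /= -/(unpair n) => ->.
  by rewrite ey -surjective_pairing.
by rewrite -(uL (maxn K L)) ?leq_maxr // -(uK (maxn K L)) ?leq_maxl.
Qed.

Definition cons_code (c : seqs -> nat) (e : code) : code :=
  fun x n => if n is m.+1 then e x m else c x.

(** The second hypothesis says that the fibres of [c] are closed in the topology of [e]. This is
    enough because convergence of the new coordinate makes it eventually constant. *)
Lemma good_cons c e : good_code e ->
  (forall u x b, pointwise_to (e \o u) (e x) -> (forall k, c (u k) = b) ->
     c x = b) ->
  good_code (cons_code c e).
Proof.
move=> ge cP u a ua.
have eua : pointwise_to (e \o u) (fun n => a n.+1) by move=> n; exact: (ua n.+1).
have [x ex ux] := ge _ _ eua; exists x => //; apply/funext => -[|n] /=.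
  have [K uK] := ua 0%N.
  apply: (cP (fun k => u (K + k)%N)); last by move=> k; apply: uK; rewrite leq_addr.
  by rewrite ex; apply: (@pointwise_to_shift (e \o u)).
by rewrite ex.
Qed.

(** * Sets that become clopen in the topology of a code *)

Definition decides (e : code) (A : set seqs) : Prop :=
  exists n, forall x y, e x n = e y n -> A x -> A y.

Lemma decides_lim e A u x : decides e A -> pointwise_to (e \o u) (e x) ->
  exists K, forall k, (K <= k)%N -> A (u k) <-> A x.
Proof.
move=> [n eA] ux; have [K uK] := ux n; exists K => k /uK /= eq_n.
by split; apply: eA.
Qed.

Lemma decides_setC e A : decides e A -> decides e (~` A).
Proof. by move=> [n eA]; exists n => x y exy nAx Ay; apply: nAx; exact: eA Ay. Qed.

Definition clopenable (A : set seqs) : Prop :=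
  exists2 e, good_code e & decides e A.

Lemma clopenable_join (A : nat -> set seqs) : (forall i, clopenable (A i)) ->
  exists2 e, good_code e & forall i, decides e (A i).
Proof.
move=> Ac; have /choice[e eP] i : exists e, good_code e /\ decides e (A i).
  by have [e] := Ac i; exists e.
exists (join_code e); first by apply: good_join => i; have [] := eP i.
move=> i; have [_ [n eA]] := eP i; exists (pickle (i, n)) => x y.
by rewrite !join_codeE; apply: eA.
Qed.

Lemma least_index (A : nat -> set seqs) x : (exists i, A i x) ->
  exists i, A i x /\ forall j, (j < i)%N -> ~ A j x.
Proof.
move=> Ax; have ex : exists i, `[< A i x >] by have [i] := Ax; exists i; apply/asboolP.
case: (ex_minnP ex) => i /asboolP Aix min_i; exists i; split=> // j lt_ji Ajx.
by have := min_i j (asboolT Ajx); rewrite leqNgt lt_ji.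
Qed.

(* The least index of a set containing [x] has closed fibres for the topology of
   [e], and records membership in the union, which is merely open. *)
Lemma clopenable_bigcup (A : nat -> set seqs) : (forall i, clopenable (A i)) ->
  clopenable (\bigcup_i A i).
Proof.
move=> /clopenable_join[e ge eA].
(* The value 0 is reserved for points outside the union, hence the shift of indices by one. *)
pose spec b x := if b is i.+1 then A i x /\ forall j, (j < i)%N -> ~ A j x
                 else forall i, ~ A i x.
have /choice[c cP] x : exists b, spec b x.
  have [/least_index[i Aix]|/forallNP nA] := pselect (exists i, A i x).
    by exists i.+1.
  by exists 0%N.
have spec_inj b b' x : spec b x -> spec b' x -> b = b'.
  case: b b' => [|i] [|j] //=.
  - by move=> nA [/nA].
  - by move=> [+ _] nA => /nA.
  move=> [Ai ltA] [Aj ltA']; congr _.+1.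
  by case: (ltngtP i j) => // [/ltA' | /ltA].
exists (cons_code c e); last first.
  exists 0%N => x y /= cxy [i _ Aix]; move: (cP x) (cP y); rewrite cxy.
  by case: (c y) => [/(_ i)//|j] _ [Ajy _]; exists j.
apply: good_cons => // u x b ux ub; apply: (spec_inj _ _ _ (cP x)).
have {ub} specu k : spec b (u k) by rewrite -(ub k).
have AE i : exists k, A i (u k) <-> A i x.
  by have [K uK] := decides_lim (eA i) ux; exists K; apply: uK.
case: b specu => [|i] specu /=.
  by move=> i; have [k <-] := AE i; apply: specu.
split; first by have [k <-] := AE i; have [] := specu k.
by move=> j lt_ji; have [k <-] := AE j; have [_] := specu k; apply.
Qed.

(** [U] is the union of the sets [A n] of points whose cylinder of length [n] lies in [U]; one extra
    coordinate recording the first [n] entries decides [A n]. *)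
Lemma clopenable_open (U : set seqs) :
  (forall x, U x -> exists n, forall y, agree id n x y -> U y) -> clopenable U.
Proof.
move=> oU; pose A n := [set x : seqs | forall y, agree id n x y -> U y].
rewrite (_ : U = \bigcup_n A n); last first.
  apply/seteqP; split=> x; first by move=> /oU[n nU]; exists n.
  by move=> [n _]; apply.
apply: clopenable_bigcup => n.
exists (cons_code (fun x => pickle (mkseq x n)) id).
  apply: good_cons => [|u x b ux ub]; first exact: good_id.
  have [K uK] := choice ux; pose M := (\max_(i < n) K i)%N.
  rewrite -(ub M); congr pickle; apply/eq_in_map => i; rewrite mem_iota add0n.
  by move=> /andP[_ lt_in]; rewrite -(uK i M) //; apply: (leq_bigmax (Ordinal lt_in)).
exists 0%N => x y /= /(pcan_inj pickleK) exy Ax z yz; apply: Ax => i lt_in /=.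
by rewrite -(yz i lt_in) /= -(nth_mkseq 0%N x lt_in) exy nth_mkseq.
Qed.

(** * The Polish space presented by a code *)

Definition code_space (e : code) : Type := seqs.

Section CodeSpace.
Variable e : code.

HB.instance Definition _ := Choice.on (code_space e).

Let code_open : set_system (code_space e) :=
  [set U | forall x, U x -> exists n, forall y, agree e n x y -> U y].

Let code_openT : code_open setT.
Proof. by move=> x _; exists 0%N. Qed.

Let code_openI : setI_closed code_open.
Proof.
move=> U V oU oV x [/oU[m mU] /oV[n nV]]; exists (maxn m n) => y xy.
by split; [apply: mU | apply: nV]; apply: agree_le xy; rewrite ?leq_maxl ?leq_maxr.
Qed.

Let code_open_bigcup (I : Type) (f : I -> set (code_space e)) :
  (forall i, code_open (f i)) -> code_open (\bigcup_i f i).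
Proof.
by move=> of_ x [i _ /of_[n nf]]; exists n => y /nf; exists i.
Qed.

HB.instance Definition _ := isOpenTopological.Build (code_space e)
  code_openT code_openI code_open_bigcup.

Lemma code_openP (U : set (code_space e)) :
  open U <-> forall x, U x -> exists n, forall y, agree e n x y -> U y.
Proof. by []. Qed.

Lemma agree_open n (x : code_space e) : open [set y : code_space e | agree e n x y].
Proof.
by apply/code_openP => y xy; exists n => z yz; exact: agree_trans xy yz.
Qed.

Lemma code_nbhsP (x : code_space e) (U : set (code_space e)) :
  nbhs x U <-> exists n, forall y, agree e n x y -> U y.
Proof.
split=> [|[n nU]].
  by rewrite nbhsE => -[V [/code_openP oV /oV[n nV]] VU]; exists n => y /nV/VU.
apply: (@filterS _ _ _ [set y : code_space e | agree e n x y]) => //.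
by apply: open_nbhs_nbhs; split; [exact: agree_open | exact: agree_refl].
Qed.

Lemma code_clopen_basis : clopen_basis (code_space e).
Proof.
split=> [U []//|x U /code_nbhsP[n nU]].
exists [set y : code_space e | agree e n x y] => //; split; last exact: agree_refl.
split; first exact: agree_open.
rewrite -openC; apply/code_openP => y nxy; exists n => z yz xz.
by apply: nxy; apply: agree_trans xz (agree_sym yz).
Qed.

(** For each finite sequence that begins some [e y], [g] picks one such [y]; there are countably
    many finite sequences. *)
Lemma code_separable : separable_space (code_space e).
Proof.
have /choice[g gP] (s : seq nat) : exists x : seqs,
    forall y, mkseq (e y) (size s) = s -> mkseq (e x) (size s) = s.
  have [[y ys]|ns] := pselect (exists y, mkseq (e y) (size s) = s); first by exists y.
  by exists id => y ys; case: ns; exists y.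
exists (range g); first exact: sub_countable (card_image_le _ _) (countableP _).
move=> U [x Ux] /code_openP/(_ _ Ux)[n nU].
exists (g (mkseq (e x) n)); split; last by exists (mkseq (e x) n).
apply: nU => i lt_in.
have eg : mkseq (e (g (mkseq (e x) n))) n = mkseq (e x) n.
  by have := gP (mkseq (e x) n) x; rewrite size_mkseq; apply.
by have := congr1 (nth 0%N ^~ i) eg; rewrite !nth_mkseq.
Qed.

Variable R : realType.

Lemma first_difference (x y : seqs) : e x <> e y ->
  exists k, e x k <> e y k /\ agree e k x y.
Proof.
move=> /eqP nxy; have /existsNP[i] : ~ forall i, e x i = e y i.
  by move=> exy; case/eqP: nxy; exact/funext.
move=> ni; have := @least_index (fun k _ => e x k <> e y k) x.
case; first by exists i.
by move=> k [nk ltk]; exists k; split=> // j /ltk /contrapT.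
Qed.

(** The usual metric of the Baire space, pulled back along [e]. *)
Definition code_dist (x y : code_space e) : R :=
  if pselect (e x = e y) is right nxy
  then (projT1 (cid (first_difference nxy))).+1%:R^-1 else 0.

Lemma code_dist_lt n x y : code_dist x y < n.+1%:R^-1 <-> agree e n.+1 x y.
Proof.
rewrite /code_dist; case: pselect => [exy|nxy].
  by split=> [_ i _|_]; [rewrite exy | rewrite invr_gt0 ltr0n].
case: cid => k /= [nk ltk]; rewrite ltf_pV2 ?posrE ?ltr0n // ltr_nat ltnS.
split=> [lt_nk|]; first exact: agree_le ltk.
by move=> xy; rewrite ltnNge; apply/negP => /xy.
Qed.

Lemma code_dist0 x y : code_dist x y = 0 <-> e x = e y.
Proof.
rewrite /code_dist; case: pselect => // nxy; split=> // /eqP.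
by rewrite invr_eq0 pnatr_eq0.
Qed.

Lemma code_dist_ge0 x y : 0 <= code_dist x y.
Proof. by rewrite /code_dist; case: pselect => // ?; rewrite invr_ge0 ler0n. Qed.

Lemma code_dist_sym x y : code_dist x y = code_dist y x.
Proof.
rewrite /code_dist; case: pselect => [exy|nxy]; case: pselect => //.
- by move=> nyx; case: nyx; rewrite exy.
- by move=> eyx; case: nxy; rewrite eyx.
move=> nyx; case: cid => k [nk ltk]; case: cid => l [nl ltl] /=.
by case: (ltngtP k l) => [/ltl/esym|/ltk/esym|->].
Qed.

Lemma code_dist_triangle x y z :
  code_dist x z <= code_dist x y + code_dist y z.
Proof.
rewrite {1}/code_dist; case: pselect => [_|nxz].
  by rewrite addr_ge0 ?code_dist_ge0.
case: cid => k [nk _] /=; rewrite leNgt; apply/negP => lt_k.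
have /code_dist_lt xy : code_dist x y < k.+1%:R^-1.
  by apply: le_lt_trans lt_k; rewrite lerDl code_dist_ge0.
have /code_dist_lt yz : code_dist y z < k.+1%:R^-1.
  by apply: le_lt_trans lt_k; rewrite lerDr code_dist_ge0.
by apply: nk; rewrite xy ?yz.
Qed.

Lemma small_natSinv (r : R) : 0 < r -> exists n, n.+1%:R^-1 < r.
Proof.
move=> r0; have [N _ /(_ N (leqnn N))] := near_infty_natSinv_lt (PosNum r0).
by exists N.
Qed.

Lemma code_polish : good_code e -> polish R (code_space e).
Proof.
move=> ge; split; first exact: code_separable.
exists code_dist; split.
- split=> [x y|x y|x y|x y z].
  + exact: code_dist_ge0.
  + by rewrite code_dist0; split=> [/(good_code_inj ge)|->].
  + exact: code_dist_sym.
  + exact: code_dist_triangle.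
- move=> U; split=> [/code_openP oU x /oU[n nU]|oU].
    exists n.+1%:R^-1; first by rewrite invr_gt0 ltr0n.
    by move=> y /= /code_dist_lt xy; apply: nU; apply: agree_le xy.
  apply/code_openP => x /oU[r /small_natSinv[n nr] rU].
  by exists n.+1 => y /code_dist_lt xy; apply: rU; apply: lt_trans nr.
move=> u cu.
have /choice[K KP] n : exists K, forall k l, (K <= k)%N -> (K <= l)%N ->
    agree e n.+1 (u k) (u l).
  have [|K uK] := cu n.+1%:R^-1; first by rewrite invr_gt0 ltr0n.
  by exists K => k l Kk Kl; apply/code_dist_lt; apply: uK.
(* The limit of the images takes its entry [n] from a stage [K n] past which that entry is constant;
   goodness supplies the point mapped to it. *)
have [|x ex _] := ge u (fun n => e (u (K n)) n).
  by move=> n; exists (K n) => k Kk /=; apply: (KP n) => //.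
exists x => U /code_nbhsP[n nU].
exists (\max_(i < n) K i)%N => // k /= Mk; apply: nU => i lt_in.
rewrite ex; apply: (KP i) => //; apply: leq_trans Mk.
exact: (leq_bigmax (Ordinal lt_in)).
Qed.

End CodeSpace.

(** Both spaces have carrier [seqs], so the topology of [code_space e] can be read as one on
    [code_space id]. *)
Lemma code_finer e : good_code e ->
  finer (Topological.class (code_space e) : Topological (code_space id)).
Proof.
move=> ge U /code_openP oU.
change (@open (code_space e) U); apply/code_openP => x /oU[n nU].
by have [m mP] := good_code_finer n x ge; exists m => y /mP/nU.
Qed.


(** * Induction on rectangles in a product of two Polish spaces *)

Lemma small_cover (R : realType) (P : topologicalType) (d : P -> P -> R) : separable_space P ->
    is_metric d -> metric_compatible d -> forall r : R, 0 < r ->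
  exists2 A : nat -> set P, \bigcup_k A k = setT &
    forall k x y, A k x -> A k y -> d x y < r.
Proof.
move=> [D /countable_injP[c c_inj] denseD] [_ d0 dsym dtri] dopen r r0.
have r20 : 0 < r / 2 by rewrite divr_gt0.
exists (fun k => [set p | exists x, [/\ D x, c x = k & d x p < r / 2]]).
  apply/seteqP; split=> // p _.
  have [||x [px Dx]] := denseD [set q | d p q < r / 2].
  - by exists p => /=; have /d0 -> : p = p by [].
  - apply/dopen => x /= px; exists (r / 2 - d p x); first by rewrite subr_gt0.
    by move=> y /=; rewrite ltrBrDl; apply: le_lt_trans.
  by exists (c x) => //; exists x; split; rewrite // dsym.
move=> k x y [a [Da ca ax]] [b [Db cb bY]].
have ab : a = b by apply: c_inj; rewrite ?inE // ca cb.
rewrite (splitr r); apply: le_lt_trans (dtri x a y) _.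
by apply: ltrD; [rewrite dsym | rewrite ab].
Qed.

(** Points chosen in the [A n] form a Cauchy sequence. Its limit need not lie in any [A n], but
    vanishing diameters bring the sets into each of its neighbourhoods. *)
Lemma shrink_to_point (R : realType) (P : topologicalType)
    (d : P -> P -> R) (A : nat -> set P) :
    is_metric d -> metric_compatible d -> metric_complete d ->
    (forall n, A n !=set0) -> (forall n, A n.+1 `<=` A n) ->
    (forall n x y, A n.+1 x -> A n.+1 y -> d x y < n.+1%:R^-1) ->
  exists p, forall U, open U -> U p -> exists N, forall n, (N <= n)%N -> A n `<=` U.
Proof.
move=> [_ d0 dsym dtri] dopen dcomp /choice[a aA] Adec Adiam.
have Amono m n : (m <= n)%N -> A n `<=` A m.
  move=> /subnK <-; elim: (n - m)%N => // k IH x.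
  by rewrite addSn => /Adec/IH.
have [r r0|p ap] := dcomp a.
  have [n nr] := small_natSinv r0; exists n.+1 => k l nk nl.
  by apply: lt_trans nr; apply: Adiam; [apply: (Amono _ k) | apply: (Amono _ l)].
exists p => U oU Up.
have [r r0 rU] := (dopen U).1 oU p Up.
have r20 : 0 < r / 2 by rewrite divr_gt0.
have [n nr] := small_natSinv r20.
have pball : nbhs p [set q | d p q < r / 2].
  apply: open_nbhs_nbhs; split; last first.
    by rewrite /=; have /d0 -> : p = p by [].
  apply/dopen => x /= px; exists (r / 2 - d p x); first by rewrite subr_gt0.
  by move=> y /=; rewrite ltrBrDl; apply: le_lt_trans.
have [K _ Ka] := ap _ pball.
exists n.+1 => m nm x Amx; apply: rU => /=; pose k := maxn K n.+1.
rewrite (splitr r); apply: le_lt_trans (dtri p (a k) x) _.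
apply: ltrD; first by apply: Ka; rewrite /= leq_maxl.
apply: lt_trans nr; apply: Adiam; last exact: Amono Amx.
by apply: (Amono _ k) => //; rewrite leq_maxr.
Qed.


(** If [sep setT setT] failed, closure under countable unions would give decreasing rectangles of
    vanishing diameter on which [sep] fails. The clauses on [set0] keep them nonempty, so they
    shrink to a point [(p, q)], near which [sep] holds. *)
Lemma polish_rectangle_ind (R : realType) (P Q : topologicalType)
    (sep : set P -> set Q -> Prop) :
    polish R P -> polish R Q ->
    (forall B, sep set0 B) -> (forall A, sep A set0) ->
    (forall A A' B B', A `<=` A' -> B `<=` B' -> sep A' B' -> sep A B) ->
    (forall (A : nat -> set P) B,
       (forall k, sep (A k) B) -> sep (\bigcup_k A k) B) ->
    (forall A (B : nat -> set Q),
       (forall k, sep A (B k)) -> sep A (\bigcup_k B k)) ->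
    (forall p q, exists U V, [/\ open U, U p, open V, V q & sep U V]) ->
  sep setT setT.
Proof.
move=> [sP [d [dm dopen dcomp]]] [sQ [d' [dm' dopen' dcomp']]].
move=> sep0l sep0r sepS sepUl sepUr sep_loc; apply: contrapT => nsep.
have step (n : nat) (AB : set P * set Q) : ~ sep AB.1 AB.2 -> exists AB' : set P * set Q,
    [/\ ~ sep AB'.1 AB'.2, AB'.1 `<=` AB.1, AB'.2 `<=` AB.2,
     forall x y, AB'.1 x -> AB'.1 y -> d x y < n.+1%:R^-1 &
     forall x y, AB'.2 x -> AB'.2 y -> d' x y < n.+1%:R^-1].
  case: AB => A B /= nAB.
  have n0 : (0 : R) < n.+1%:R^-1 by rewrite invr_gt0 ltr0n.
  have [C CT Cd] := small_cover sP dm dopen n0.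
  have [D DT Dd] := small_cover sQ dm' dopen' n0.
  have [k nk] : exists k, ~ sep (A `&` C k) B.
    apply/existsNP => sepk; apply: nAB; rewrite -(setIT A) -CT setI_bigcupr.
    exact: sepUl.
  have [l nl] : exists l, ~ sep (A `&` C k) (B `&` D l).
    apply/existsNP => sepl; apply: nk; rewrite -(setIT B) -DT setI_bigcupr.
    exact: sepUr.
  exists (A `&` C k, B `&` D l); split=> /=; [exact: nl| | | | ].
  - exact: subIsetl.
  - exact: subIsetl.
  - by move=> x y [_ Cx] [_ Cy]; exact: Cd Cx Cy.
  - by move=> x y [_ Dx] [_ Dy]; exact: Dd Dx Dy.
(* The recursion needs a total [g], which leaves a rectangle unchanged when [sep] holds on it. *)
have /choice[g gP] (nAB : nat * (set P * set Q)) : exists AB' : set P * set Q,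
    ~ sep nAB.2.1 nAB.2.2 ->
    [/\ ~ sep AB'.1 AB'.2, AB'.1 `<=` nAB.2.1, AB'.2 `<=` nAB.2.2,
     forall x y, AB'.1 x -> AB'.1 y -> d x y < nAB.1.+1%:R^-1 &
     forall x y, AB'.2 x -> AB'.2 y -> d' x y < nAB.1.+1%:R^-1].
  have [s|/(step nAB.1)[AB' ABP]] := pselect (sep nAB.2.1 nAB.2.2); last by exists AB'.
  by exists nAB.2 => /(_ s).
pose AB := fix AB n := if n is m.+1 then g (m, AB m) else (setT, setT).
have nsepAB n : ~ sep (AB n).1 (AB n).2.
  by elim: n => // n IH; have [] := gP (n, AB n) IH.
have [p pP] : exists p, forall U, open U -> U p ->
    exists N, forall n, (N <= n)%N -> (AB n).1 `<=` U.
  apply: (shrink_to_point dm dopen dcomp) => n; last by have [] := gP (n, AB n) (nsepAB n).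
  - by apply/set0P/eqP => A0; apply: (nsepAB n); rewrite A0.
  - by have [] := gP (n, AB n) (nsepAB n).
have [q qP] : exists q, forall V, open V -> V q ->
    exists N, forall n, (N <= n)%N -> (AB n).2 `<=` V.
  apply: (shrink_to_point dm' dopen' dcomp') => n; last by have [] := gP (n, AB n) (nsepAB n).
  - by apply/set0P/eqP => A0; apply: (nsepAB n); rewrite A0.
  - by have [] := gP (n, AB n) (nsepAB n).
have [U [V [oU Up oV Vq sepUV]]] := sep_loc p q.
have [M MU] := pP U oU Up; have [N NV] := qP V oV Vq.
apply: (nsepAB (maxn M N)); apply: sepS sepUV.
  by apply: MU; rewrite leq_maxl.
by apply: NV; rewrite leq_maxr.
Qed.

Notation baire := (code_space id).

(** * Borel sets *)

Section Borel.
Variable T : topologicalType.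
Implicit Types (A B : set T) (F : nat -> set T).

Lemma open_borel A : open A -> borel A.
Proof. exact: sub_gen_smallest. Qed.

Lemma borel_set0 : borel (@set0 T).
Proof. by have [] := smallest_sigma_algebra (@setT T) open. Qed.

Lemma borelC A : borel A -> borel (~` A).
Proof.
by have [_ + _] := smallest_sigma_algebra (@setT T) open; rewrite -setTD; apply.
Qed.

Lemma borel_setT : borel (@setT T).
Proof. by rewrite -setC0; exact: borelC borel_set0. Qed.

Lemma borel_bigcup F : (forall k, borel (F k)) -> borel (\bigcup_k F k).
Proof. by have [_ _] := smallest_sigma_algebra (@setT T) open; apply. Qed.

Lemma borel_bigcap F : (forall k, borel (F k)) -> borel (\bigcap_k F k).
Proof.
move=> bF; rewrite -[X in borel X]setCK setC_bigcap; apply: borelC.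
by apply: borel_bigcup => k; apply: borelC.
Qed.

Lemma borelI A B : borel A -> borel B -> borel (A `&` B).
Proof.
move=> bA bB.
rewrite (_ : A `&` B = \bigcap_k (if k is 0%N then A else B)).
  by apply: borel_bigcap => -[].
apply/seteqP; split=> [x [Ax Bx] [|k]//|x AB].
by split; [exact: (AB 0%N) | exact: (AB 1%N)].
Qed.

Lemma borelD A B : borel A -> borel B -> borel (A `\` B).
Proof. by move=> bA bB; rewrite setDE; apply: borelI => //; apply: borelC. Qed.

End Borel.

Lemma borel_preimage (S T : topologicalType) (f : S -> T) (A : set T) :
  continuous f -> borel A -> borel (f @^-1` A).
Proof.
move=> /continuousP cf; move: A.
apply: smallest_sub => [|U oU]; last by apply: open_borel; apply: cf.
split=> [|A bA|F bF].
- by rewrite preimage_set0; apply: borel_set0.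
- by rewrite setTD preimage_setC; apply: borelC.
- by rewrite preimage_bigcup; apply: borel_bigcup.
Qed.

(** The clopenable sets form a sigma-algebra containing the open sets. *)
Lemma borel_clopenable (A : set baire) : borel A -> clopenable A.
Proof.
move: A; apply: smallest_sub => [|U /code_openP oU]; last exact: clopenable_open.
split=> [|A [e ge eA]|F cF].
- by apply: clopenable_open.
- by rewrite setTD; exists e => //; apply: decides_setC.
- exact: clopenable_bigcup.
Qed.

(** * Luzin separation and sets with unique vertical sections *)

Lemma cylinder_open i j : open [set y : baire | y i = j].
Proof. by apply/code_openP => x <-; exists i.+1 => y /(_ i (ltnSn i)). Qed.

Lemma cylinderC_open i j : open (~` [set y : baire | y i = j]).
Proof. by apply/code_openP => x; exists i.+1 => y /(_ i (ltnSn i)) /= <-. Qed.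

(* Luzin's separation argument, relative to subsets [F] and [G] of the
   parameter spaces that need not be Borel. *)
Lemma luzin_separation (R : realType) (P Q : topologicalType)
    (x : P -> baire) (y : Q -> baire) (F : set P) (G : set Q) :
    polish R P -> polish R Q -> continuous x -> continuous y ->
    (forall p q, x p = y q -> exists U V D,
       [/\ open U, U p, open V, V q & borel D /\
         ((forall p', U p' -> F p' -> D (x p')) /\
          (forall q', V q' -> G q' -> ~ D (y q')))]) ->
  exists2 D, borel D &
    (forall p, F p -> D (x p)) /\ (forall q, G q -> ~ D (y q)).
Proof.
move=> pP pQ /continuousP cx /continuousP cy loc.
pose sep (A : set P) (B : set Q) := exists2 D, borel D &
  (forall p, A p -> F p -> D (x p)) /\ (forall q, B q -> G q -> ~ D (y q)).
suff [D bD [DF DG]] : sep setT setT.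
  by exists D => //; split=> [p|q]; [apply: DF | apply: DG].
apply: (polish_rectangle_ind pP pQ).
- by move=> B; exists set0; [exact: borel_set0 | split=> [p []|q _ _ []]].
- by move=> A; exists setT; [exact: borel_setT | split=> [p|q []]].
- move=> A A' B B' AA' BB' [D bD [DA DB]]; exists D => //.
  by split=> [p /AA'|q /BB']; [apply: DA | apply: DB].
- move=> A B sepA; have /choice[D DP] k : exists D, borel D /\
      ((forall p, A k p -> F p -> D (x p)) /\ (forall q, B q -> G q -> ~ D (y q))).
    by have [D] := sepA k; exists D.
  exists (\bigcup_k D k); first by apply: borel_bigcup => k; have [] := DP k.
  split=> [p [k _ Akp] Fp|q Bq Gq [k _]]; have [_ [DA DB]] := DP k.
    by exists k => //; apply: DA.
  exact: DB.
- move=> A B sepB; have /choice[D DP] k : exists D, borel D /\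
      ((forall p, A p -> F p -> D (x p)) /\ (forall q, B k q -> G q -> ~ D (y q))).
    by have [D] := sepB k; exists D.
  exists (\bigcap_k D k); first by apply: borel_bigcap => k; have [] := DP k.
  split=> [p Ap Fp k _|q [k _ Bkq] Gq /(_ k I)]; have [_ [DA DB]] := DP k.
    exact: DA.
  exact: DB.
move=> p q; have [/loc[U [V [D [oU Up oV Vq [bD UV]]]]]|nxy] := pselect (x p = y q).
  by exists U, V; split=> //; exists D.
have [i ni] : exists i, x p i <> y q i.
  by apply/existsNP => xy; apply: nxy; apply/funext.
(* Where [x p] and [y q] differ at [i], a cylinder at [i] already separates neighbourhoods. *)
exists (x @^-1` [set z | z i = x p i]), (y @^-1` ~` [set z | z i = x p i]).
split=> //; [exact/cx/cylinder_open|exact/cy/cylinderC_open|by move/esym/ni|].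
by exists [set z : baire | z i = x p i]; [exact: (open_borel (@cylinder_open _ _)) | split].
Qed.

(* For disjoint [B0], [B1] with at most one point in each vertical section, the
   cylinders [y i = j] separate the two values; their traces are made Borel by
   [luzin_separation]. *)
Lemma unique_sections_separation (R : realType) (P Q : topologicalType)
    (u : P -> baire * baire) (v : Q -> baire * baire) :
    polish R P -> polish R Q -> continuous u -> continuous v ->
    (forall p p', (u p).1 = (u p').1 -> u p = u p') ->
    (forall q q', (v q).1 = (v q').1 -> v q = v q') ->
    (forall p q, u p <> v q) ->
  exists (G : nat -> set baire) (V : nat -> set baire),
    [/\ forall k, borel (G k) /\ clopen (V k),
        forall x, exists k, G k x,
        forall k l x, G k x -> G l x -> k = l,
        forall p, exists k, G k (u p).1 /\ V k (u p).2 &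
        forall q, exists k, G k (v q).1 /\ ~ V k (v q).2].
Proof.
move=> pP pQ cu cv u_fun v_fun u_v.
have c1 (S : topologicalType) (w : S -> baire * baire) :
    continuous w -> continuous (fst \o w).
  by move=> cw s; apply: continuous_comp; [exact: cw | exact: cvg_fst].
have c2 (S : topologicalType) (w : S -> baire * baire) :
    continuous w -> continuous (snd \o w).
  by move=> cw s; apply: continuous_comp; [exact: cw | exact: cvg_snd].
(* Equal first coordinates force [w s = w s'], so one of [(w s).2 i = j] and [(w s').2 i <> j]
   fails, and by continuity fails nearby; there [setT] or [set0] separates. *)
have trace (S : topologicalType) (w : S -> baire * baire) : polish R S ->
    continuous w -> (forall s s', (w s).1 = (w s').1 -> w s = w s') ->
    forall i j, exists D, borel D /\ forall s, D (w s).1 <-> (w s).2 i = j.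
  move=> pS cw w_fun i j.
  have cw2 := (continuousP _).1 (c2 _ _ cw).
  have [|D bD [DF DG]] := @luzin_separation R S S (fst \o w) (fst \o w)
      [set s | (w s).2 i = j] [set s | (w s).2 i <> j] pS pS (c1 _ _ cw) (c1 _ _ cw).
    move=> s s' /w_fun ww'; have [wj|wj] := pselect ((w s).2 i = j).
      exists setT, ((snd \o w) @^-1` [set z | z i = j]), setT.
      split=> //; [exact: openT|exact/cw2/cylinder_open|by rewrite /= -ww'|].
      by split; [exact: borel_setT | split].
    exists ((snd \o w) @^-1` ~` [set z | z i = j]), setT, set0.
    split=> //; [exact/cw2/cylinderC_open|exact: openT|].
    by split; [exact: borel_set0 | split=> [s0 /= nj /nj|s0 _ _ []]].
  exists D; split=> // s; split=> [Dw|]; last exact: DF.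
  by apply: contrapT => /DG.
have /choice[M MP] n := trace _ _ pP cu u_fun (unpair n).1 (unpair n).2.
have /choice[L LP] n := trace _ _ pQ cv v_fun (unpair n).1 (unpair n).2.
(* Over a point of [A n], the cylinder coded by [n] contains the value of [u], if any, and not that
   of [v]. *)
pose A n := M n `\` L n.
have bA n : borel (A n).
  by apply: borelD; [have [] := MP n | have [] := LP n].
pose rest : set baire := ~` \bigcup_n A n.
have brest : borel rest by apply: borelC; apply: borel_bigcup.
(* If [u] and [v] both have a value over a point, a coordinate where these differ puts the point in
   some [A n]. So inside [rest] the two projections are disjoint. *)
have [|D bD [Du Dv]] := @luzin_separation R P Q (fst \o u) (fst \o v)
    [set p | rest (u p).1] [set q | rest (v q).1] pP pQ (c1 _ _ cu) (c1 _ _ cv).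
  move=> p q /= uv1.
  have [i ni] : exists i, (u p).2 i <> (v q).2 i.
    apply/existsNP => uv2; apply: (u_v p q).
    by rewrite [u p]surjective_pairing [v q]surjective_pairing uv1 (funext uv2).
  pose n := pickle (i, (u p).2 i).
  have nE : unpair n = (i, (u p).2 i) by rewrite /n unpairK.
  have [bM Mn] := MP n; have [_ Ln] := LP n.
  (* The local separator is [M n]: near [q] the first coordinates avoid [L n], so one that lies in
     [M n] lies in [A n], hence outside [rest]. *)
  exists ((snd \o u) @^-1` [set z | z i = (u p).2 i]),
         ((snd \o v) @^-1` ~` [set z | z i = (u p).2 i]), (M n).
  split=> //; [exact/((continuousP _).1 (c2 _ _ cu))/cylinder_open| | |].
  - exact/((continuousP _).1 (c2 _ _ cv))/cylinderC_open.
  - by move=> /= /esym.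
  split=> //; split=> [p' /= up' _|q' /= vq' rq' Mq']; first by apply/Mn; rewrite nE.
  by apply: rq'; exists n => //; split=> // /Ln; rewrite nE.
(* Inside [rest], [D] contains no first coordinate of [v] and its complement none of [u], so [V] can
   be full and empty there. The [A n] are shifted by two and made disjoint. *)
pose G k := match k with
  | 0%N => rest `&` D
  | 1%N => rest `\` D
  | n.+2 => A n `\` \bigcup_m (if (m < n)%N then A m else set0)
  end.
pose V k : set baire := match k with
  | 0%N => setT
  | 1%N => set0
  | n.+2 => [set y | y (unpair n).1 = (unpair n).2]
  end.
have Gcover x : exists k, G k x.
  have [/least_index[n [Anx ltA]]|nA] := pselect (exists n, A n x).
    exists n.+2; split=> // -[m _]; case: ifP => // lt_mn; exact: ltA.
  have rx : rest x by move=> [n _ Anx]; apply: nA; exists n.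
  by have [Dx|nDx] := pselect (D x); [exists 0%N | exists 1%N].
have Gn n x : G n.+2 x -> ~ rest x by move=> [Anx _]; apply; exists n.
have Guniq k l x : G k x -> G l x -> k = l.
  case: k l => [|[|k]] [|[|l]] //.
  - by move=> [_ Dx] [_ nDx].
  - by move=> [rx _] /Gn.
  - by move=> [_ nDx] [_ Dx].
  - by move=> [rx _] /Gn.
  - by move=> /Gn + [].
  - by move=> /Gn + [].
  move=> [Ak ltk] [Al ltl]; case: (ltngtP k l) => [lt_kl|lt_lk|->//].
    by case: ltl; exists k => //; rewrite lt_kl.
  by case: ltk; exists l => //; rewrite lt_lk.
exists G, V; split=> //.
- move=> [|[|n]]; split.
  + exact: borelI.
  + exact: clopenT.
  + exact: borelD.
  + exact: clopen0.
  + apply: borelD => //; apply: borel_bigcup => m.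
    by case: ifP => // _; exact: borel_set0.
  + split; first exact: cylinder_open.
    by rewrite -openC; exact: cylinderC_open.
- move=> p; have [k Gk] := Gcover (u p).1; exists k; split=> //.
  case: k Gk => [|[|n]] //; first by move=> [/Du Dp nDp].
  by move=> [[Mn _] _]; have [_ /(_ p)[+ _]] := MP n; apply.
- move=> q; have [k Gk] := Gcover (v q).1; exists k; split=> //.
  case: k Gk => [|[|n]] //; first by move=> [rq Dq] _; exact: Dv rq Dq.
    by move=> _ [].
  move=> [[_ nL] _] Vq; apply: nL.
  by have [_ /(_ q)[_]] := LP n; apply.
Qed.

(** One code decides all the [G k]. With its topology on the first factor the set is a union of open
    rectangles; as the [G k] form a partition, so is the complement, with each [V k]
    complemented. *)
Lemma pot_clopen_partition (R : realType) (G V : nat -> set baire) :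
    (forall k, borel (G k) /\ clopen (V k)) ->
    (forall x, exists k, G k x) ->
    (forall k l x, G k x -> G l x -> k = l) ->
  pot_clopen R [set xy : baire * baire | exists k, G k xy.1 /\ V k xy.2].
Proof.
move=> GV Gcover Guniq; set C := [set xy | _].
have bG k : borel (G k) by have [] := GV k.
have oV k : open (V k) by have [_ []] := GV k.
have oVC k : open (~` V k) by rewrite openC; have [_ []] := GV k.
split.
  rewrite (_ : C = \bigcup_k (fst @^-1` G k `&` snd @^-1` V k)); last first.
    by apply/seteqP; split=> [xy [k [Gk Vk]]|xy [k _ [Gk Vk]]]; exists k.
  apply: borel_bigcup => k; apply: borelI.
    by apply: borel_preimage => // xy; exact: cvg_fst.
  by apply: borel_preimage; [move=> xy; exact: cvg_snd | exact: open_borel].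
have [e ge eG] := clopenable_join (fun k => borel_clopenable (bG k)).
exists (Topological.class (code_space e)), (Topological.class baire).
have rect_open (W : nat -> set baire) : (forall k, open (W k)) ->
    @open (code_space e * baire)%type
      [set xy | exists k, G k xy.1 /\ W k xy.2].
  move=> oW; rewrite openE => -[x y] [k [/= Gkx Wky]].
  have [n eGk] := eG k.
  exists ([set x' : code_space e | agree e n.+1 x x'], W k) => /=; last first.
    move=> [x' y'] [/= xx' Wy']; exists k; split=> //=.
    by apply: eGk Gkx; apply: xx'.
  split; last exact: open_nbhs_nbhs.
  apply: open_nbhs_nbhs; split; [exact: agree_open | exact: agree_refl].
split.
- by split; [exact: (code_finer ge) | exact: (code_finer good_id)].
- by split; [exact: (code_polish R ge) | exact: (code_polish R good_id)].
- by split; [exact: (@code_clopen_basis e) | exact: (@code_clopen_basis id)].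
split; first exact: (rect_open V).
rewrite -openC (_ : ~` C = [set xy | exists k, G k xy.1 /\ (~` V k) xy.2]).
  exact: (rect_open (fun k => ~` V k)).
apply/seteqP; split=> [[x y] nC|[x y] [k [/= Gk nVk]] [l [/= Gl Vl]]].
  by have [k Gk] := Gcover x; exists k; split=> //= Vk; apply: nC; exists k.
by apply: nVk; rewrite (Guniq k l x Gk Gl).
Qed.

Lemma pot_clopen_setC (R : realType) (X Y : topologicalType) (C : set (X * Y)) :
  pot_clopen R C -> pot_clopen R (~` C).
Proof.
move=> [bC [c0 [c1 [f01 p01 b01 [oC cC]]]]]; split; first exact: borelC.
by exists c0, c1; split=> //; split; [rewrite openC | rewrite closedC].
Qed.

(** * The diagonal of the Baire space and its complement *)

Lemma baire_uncountable : ~ countable [set: baire].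
Proof.
move=> /countable_injP[c c_inj].
have /choice[g gP] n : exists x : seqs, forall y : seqs, c y = n -> y = x.
  have [[x cx]|nx] := pselect (exists x, c x = n).
    by exists x => y cy; apply: c_inj; rewrite ?inE // cx cy.
  by exists id => y cy; case: nx; exists y.
pose d : seqs := fun n => (g n n).+1.
by have /(congr1 (fun f => f (c d))) := gP (c d) d erefl; move=> /esym/n_Sn.
Qed.

Local Notation diag := [set xy : baire * baire | xy.1 = xy.2].

(* An open subset of the diagonal of [Y0 * Y1] forces its points to be isolated
   in [Y0]. *)
Lemma diag_not_pot_clopen (R : realType) : ~ pot_clopen R diag.
Proof.
move=> [_ [c0 [c1 [_ [[[D cD denseD] _] _] _ [oC _]]]]].
apply: baire_uncountable; apply: sub_countable cD; apply: subset_card_le => x _.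
move: oC; rewrite openE => /(_ (x, x) erefl)[[U V] [Ux Vx] UV].
have : nbhs (x : Topological.Pack c0) U := Ux; rewrite nbhsE => -[W [oW Wx] WU].
(* The rectangle lies in the diagonal, so the countable dense [D] can meet [W] only at [x]; hence
   every point is in [D]. *)
have [|y [Wy Dy]] := denseD W _ oW; first by exists x.
suff <- : y = x by [].
apply: (UV (y, x)); split; first exact: WU.
exact: (@nbhs_singleton (Topological.Pack c1) x V Vx).
Qed.

Lemma continuous_pair (S T U : topologicalType) (f : S -> T) (g : S -> U) :
  continuous f -> continuous g -> continuous (fun s => (f s, g s)).
Proof. by move=> cf cg s; exact: (cvg_pair (cf s) (cg s)). Qed.

Lemma diag_analytic (R : realType) : analytic R diag.
Proof.
exists baire, (fun x => (x, x)); split; first exact: (code_polish R good_id).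
  by apply: continuous_pair => x; exact: cvg_id.
by apply/seteqP; split=> [_ [x _ <-]|[x y] /= ->] //; exists y.
Qed.

Lemma baire_continuousP (S : topologicalType) (f : S -> baire) :
  continuous f <-> forall s i, \forall t \near s, f t i = f s i.
Proof.
split=> [cf s i|floc s U /code_nbhsP[n nU]].
  apply: (cf s [set y : baire | y i = f s i]); apply: open_nbhs_nbhs.
  by split=> //; exact: cylinder_open.
have : \forall t \near s, forall i, (i < n)%N -> f t i = f s i.
  elim: n {nU} => [|n IH]; first exact: filterE.
  apply: filterS2 (floc s n) IH => t fn fi i.
  by rewrite ltnS leq_eqVlt => /predU1P[->|/fi].
by apply: filterS => t fi; apply: nU => i /fi.
Qed.

(* [a 0] is the first difference of the two sequences, which are then read off
   the odd and the positive even entries of [a]. *)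
Lemma diagC_analytic (R : realType) : analytic R (~` diag).
Proof.
pose left (a : baire) : baire := fun i => a i.*2.+1.
(* Before index [a 0] both sequences read the same entries; at that index a coincidence is broken by
   a successor, so every [a] gives distinct sequences. *)
pose right (a : baire) : baire := fun i =>
  if (i < a 0%N)%N then a i.*2.+1 else
  if i == a 0%N then
    if a i.*2.+2 == a i.*2.+1 then (a i.*2.+1).+1 else a i.*2.+2
  else a i.*2.+2.
have cleft : continuous left.
  apply/baire_continuousP => a i; apply/code_nbhsP; exists i.*2.+2 => b ab.
  by rewrite /left -[LHS]ab.
have cright : continuous right.
  apply/baire_continuousP => a i; apply/code_nbhsP; exists i.*2.+3 => b ab.
  have {}ab j : (j < i.*2.+3)%N -> b j = a j by move=> /ab.
  by rewrite /right !ab.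
exists baire, (fun a => (left a, right a)).
split; [exact: (code_polish R good_id)|exact: continuous_pair|].
apply/seteqP; split=> [_ [a _ <-] /= /(congr1 (fun f => f (a 0%N)))|[x y] /= nxy].
  rewrite /left /right ltnn eqxx; case: eqP => [_|ne e]; first exact: n_Sn.
  by apply: ne.
have [k [nk ltk]] := @first_difference id x y nxy.
pose a : seqs := fun n => if n is m.+1 then if odd m then y m./2 else x m./2 else k.
have a1 i : a i.*2.+1 = x i by rewrite /a odd_double doubleK.
have a2 i : a i.*2.+2 = y i by rewrite /a /= odd_double uphalf_double.
exists a => //; congr pair; apply/funext => i; rewrite /left /right ?a1 ?a2 //.
case: ifP => [/ltk//|_]; case: eqP => // ->; case: eqP => // yx.
by case: nk; rewrite /= yx.
Qed.

(** * Interleaving two reductions, and the contradiction *)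

Definition interleave (x y : seqs) : baire :=
  fun n => if odd n then y n./2 else x n./2.

Lemma interleave_inj x y x' y' :
  interleave x y = interleave x' y' -> x = x' /\ y = y'.
Proof.
move=> xy; split; apply/funext => i.
  by have := congr1 (fun f => f i.*2) xy; rewrite /interleave odd_double doubleK.
have := congr1 (fun f => f i.*2.+1) xy.
by rewrite /interleave /= odd_double uphalf_double.
Qed.

Lemma continuous_interleave (S : topologicalType) (f g : S -> baire) :
  continuous f -> continuous g -> continuous (fun s => interleave (f s) (g s)).
Proof.
move=> /baire_continuousP cf /baire_continuousP cg; apply/baire_continuousP => s i.
by rewrite /interleave; case: ifP => _; [exact: cg | exact: cf].
Qed.

Lemma continuous_prod_map (Z0 Z1 X0 X1 : topologicalType)
    (f0 : Z0 -> X0) (f1 : Z1 -> X1) :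
  continuous f0 -> continuous f1 -> continuous (prod_map f0 f1).
Proof.
move=> cf0 cf1; apply: continuous_pair => z.
  by apply: (@continuous_comp _ _ _ fst f0); [exact: cvg_fst | exact: cf0].
by apply: (@continuous_comp _ _ _ snd f1); [exact: cvg_snd | exact: cf1].
Qed.

Lemma analytic_image (R : realType) (S T : topologicalType) (f : S -> T)
    (A : set S) : continuous f -> analytic R A -> analytic R (f @` A).
Proof.
move=> cf [P [g [pP cg <-]]]; exists P, (f \o g); split=> //.
  by move=> p; apply: continuous_comp; [exact: cg | exact: cf].
by rewrite image_comp.
Qed.

Lemma unique_sections_pot_clopen_separable (R : realType)
    (B0 B1 : set (baire * baire)) :
    analytic R B0 -> analytic R B1 -> B0 `&` B1 = set0 ->
    (forall x y y', B0 (x, y) -> B0 (x, y') -> y = y') ->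
    (forall x y y', B1 (x, y) -> B1 (x, y') -> y = y') ->
  pot_clopen_separable R B0 B1.
Proof.
move=> [P [u [pP cu uB]]] [Q [v [pQ cv vB]]] B01 B0_fun B1_fun.
have Bu p : B0 (u p) by rewrite -uB; exists p.
have Bv q : B1 (v q) by rewrite -vB; exists q.
have [| | |G [V [GV Gcover Guniq GVu GVv]]] :=
  @unique_sections_separation R P Q u v pP pQ cu cv.
- move=> p p'; move: (Bu p) (Bu p'); case: (u p) (u p') => [x y] [x' y'] Bp Bp' /= xx'.
  by move: Bp; rewrite xx' => Bp; rewrite (B0_fun _ _ _ Bp Bp').
- move=> q q'; move: (Bv q) (Bv q'); case: (v q) (v q') => [x y] [x' y'] Bq Bq' /= xx'.
  by move: Bq; rewrite xx' => Bq; rewrite (B1_fun _ _ _ Bq Bq').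
- move=> p q upvq; suff : (B0 `&` B1) (u p) by rewrite B01.
  by split; [exact: Bu | rewrite upvq; exact: Bv].
exists [set xy | exists k, G k xy.1 /\ V k xy.2]; split.
- exact: pot_clopen_partition.
- by move=> xy; rewrite -uB => -[p _ <-]; exact: GVu.
apply/seteqP; split=> // xy [[k [Gk Vk]]]; rewrite -vB => -[q _ vq].
have [l [Gl nVl]] := GVv q; apply: nVl; rewrite vq in Gl *.
by rewrite -(Guniq k l _ Gk Gl).
Qed.

Theorem theorem7p8 (R : realType) :
  ~ exists (Z0 Z1 : topologicalType) (S0 S1 : set (Z0 * Z1)),
      disjoint_analytic_tuple R S0 S1 /\
      forall (X0 X1 : topologicalType) (B0 B1 : set (X0 * X1)),
        disjoint_analytic_tuple R B0 B1 ->
        exactly_one (pot_clopen_separable R B0 B1) (reduces S0 S1 B0 B1).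
Proof.
move=> [Z0 [Z1 [S0 [S1 [[_ aS0 aS1 S01] min_S]]]]].
have pbaire : polish R baire := code_polish R good_id.
(* A set separating the diagonal from its complement is the diagonal itself, so only the reduction
   remains. *)
have [[[C [pC dC Cd]] _]|[_ [f0 [f1 [cf0 cf1 f_inj fS0 fS1]]]]] :
    exactly_one (pot_clopen_separable R diag (~` diag)) (reduces S0 S1 diag (~` diag)).
- apply: min_S; split; [by []|exact: diag_analytic|exact: diagC_analytic|].
  exact: setICr.
- apply: (@diag_not_pot_clopen R); rewrite (_ : diag = C) //.
  apply/seteqP; split=> // xy Cxy; apply: contrapT => nxy.
  by suff : (C `&` ~` diag) xy by rewrite Cd.
(* The reversed order sends [S1] into the diagonal, which will control the sections of its image. *)
have [[[C [pC dC Cd]] _]|[_ [g0 [g1 [cg0 cg1 g_inj gS0 gS1]]]]] :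
    exactly_one (pot_clopen_separable R (~` diag) diag) (reduces S0 S1 (~` diag) diag).
- apply: min_S; split; [by []|exact: diagC_analytic|exact: diag_analytic|].
  exact: setICl.
- apply: (@diag_not_pot_clopen R); rewrite (_ : diag = ~` C); first exact: pot_clopen_setC.
  apply/seteqP; split=> [xy dxy Cxy|xy nCxy].
    by suff : (C `&` diag) xy by rewrite Cd.
  by apply: contrapT => /dC.
(* [h] inherits from [(f0, f1)] its injectivity on the union of [S0] and [S1]. *)
pose h0 z := interleave (f0 z) (g0 z); pose h1 z := interleave (f1 z) (g1 z).
pose h := prod_map h0 h1.
have ch0 : continuous h0 by exact: continuous_interleave.
have ch1 : continuous h1 by exact: continuous_interleave.
have ch : continuous h by exact: continuous_prod_map.
have h01 : h @` S0 `&` h @` S1 = set0.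
  apply/seteqP; split=> // _ [[s Ss <-] [t St]].
  rewrite /h /prod_map => -[/interleave_inj[f0st _] /interleave_inj[f1st _]].
  by apply: (fS1 _ St); rewrite /= f0st f1st; exact: fS0.
have aB0 : analytic R (h @` S0) by exact: analytic_image.
have aB1 : analytic R (h @` S1) by exact: analytic_image.
(* [h] is a reduction to the images, so these cannot be separable. *)
have [[_ []]|[nsep _]] := min_S baire baire (h @` S0) (h @` S1)
  (And4 (conj pbaire pbaire) aB0 aB1 h01).
  exists h0, h1; split=> //.
  - move=> s t Ss St; rewrite /prod_map => -[/interleave_inj[f0st _] /interleave_inj[f1st _]].
    by apply: f_inj => //; rewrite /prod_map f0st f1st.
  - by move=> s Ss; exists s.
  - by move=> s Ss; exists s.
apply: nsep; apply: unique_sections_pot_clopen_separable => //.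
- move=> x y y' [s Ss]; rewrite /h /prod_map => -[hsx <-] [t St] [htx <-].
  suff -> : s = t by [].
  apply: f_inj; rewrite ?inE; [by left|by left|].
  move: hsx; rewrite -htx => /interleave_inj[f0st _].
  (* On [S0] the pair [(f0, f1)] takes values in the diagonal, so the first coordinate, recovered
     from [h0], determines the second and hence the point. *)
  have es : f0 s.1 = f1 s.2 := fS0 s Ss; have et : f0 t.1 = f1 t.2 := fS0 t St.
  by rewrite /prod_map -es -et f0st.
- move=> x y y' [s Ss]; rewrite /h /prod_map => -[hsx <-] [t St] [htx <-].
  suff -> : s = t by [].
  apply: g_inj; rewrite ?inE; [by right|by right|].
  move: hsx; rewrite -htx => /interleave_inj[_ g0st].
  (* On [S1] it is [(g0, g1)] that takes values in the diagonal. *)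
  have es : g0 s.1 = g1 s.2 := gS1 s Ss; have et : g0 t.1 = g1 t.2 := gS1 t St.
  by rewrite /prod_map -es -et g0st.
Qed.
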